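(* For every $x \in (0,3.1)$ the following double-sided inequality holds: $$\left(\frac{\sin x}{x}\right)^{p_1(x)} \;<\; \cos^{2}\frac{x}{2} \;<\; \left(\frac{\sin x}{x}\right)^{p_2(x)},$$ where $p_1(x) = \frac{3}{2} + \frac{x^2}{2\pi^2}$ and $p_2(x) = \frac{3}{2} + \frac{x^2}{80}$. *)

(* Defs.v *)
From Stdlib Require Import Reals.
Open Scope R_scope.

Definition p1 (x : R) : R := 3 / 2 + x ^ 2 / (2 * PI ^ 2).

Definition p2 (x : R) : R := 3 / 2 + x ^ 2 / 80.

(* Main.v *)
Require Import Defs.
From Stdlib Require Import Reals Lra Lia Machin Factorial.
From Coquelicot Require Import Coquelicot.
Open Scope R_scope.

(** Write A = - ln (sin x / x), B = - 2 ln cos (x / 2), p = 3/2 + c x^2 and G = B - p A. The two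
    inequalities say that G > 0 for c = 1/80 and G < 0 for c = 1 / (2 PI^2); since PI^2 < 10,
    the latter follows from G < 0 for c = 1/20. Both G and G'/x vanish at 0, so the sign of G
    is that of (G'/x)', in which the logarithms have cancelled. Up to the positive factor
    x^3 sin^2 x this derivative is a polynomial in x, sin x and cos x, linear in
    the sines and cosines of x and 2x, whose sign is read off Taylor bounds. *)

(** * Numerical bounds on [PI] *)

Lemma PI_gt_3_1 : 3.1 < PI.
Proof.
  (* Partial sums of the alternating series for PI/4 = 2 arctan(1/3) + arctan(1/7). *)
  destruct (PI_2_3_7_ineq 1) as [H _].
  unfold tg_alt, PI_2_3_7_tg, Ratan_seq in H; simpl in H; lra.
Qed.

Lemma PI_sqr_lt_10 : PI ^ 2 < 10.
Proof.
  destruct (PI_2_3_7_ineq 1) as [_ H].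
  unfold tg_alt, PI_2_3_7_tg, Ratan_seq in H; simpl in H.
  pose proof PI_gt_3_1; nra.
Qed.

(** * Taylor bounds for sine and cosine on the half-line *)

Lemma nonneg_of_deriv (f df : R -> R) :
  (forall x, is_derive f x (df x)) -> (forall x, 0 <= x -> 0 <= df x) ->
  0 <= f 0 -> forall x, 0 <= x -> 0 <= f x.
Proof.
  intros Hd Hp H0 x Hx.
  destruct (MVT_gen f 0 x df) as [y [Hy E]].
  - intros; apply Hd.
  - intros y _; apply continuity_pt_filterlim, (ex_derive_continuous (V := R_NormedModule));
      eexists; apply Hd.
  - rewrite Rmin_left, Rmax_right in Hy by assumption.
    pose proof (Hp y (proj1 Hy)); nra.
Qed.

Lemma is_derive_pow_fact (k : nat) (x : R) :
  is_derive (fun x => x ^ S k / INR (fact (S k))) x (x ^ k / INR (fact k)).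
Proof.
  apply (is_derive_ext (fun x => / INR (fact (S k)) * x ^ S k)); [intros; apply Rmult_comm|].
  replace (x ^ k / INR (fact k)) with (/ INR (fact (S k)) * (INR (S k) * 1 * x ^ pred (S k))).
  - apply is_derive_scal, is_derive_pow; apply (is_derive_id (K := R_AbsRing)).
  - rewrite fact_simpl, mult_INR; simpl pred.
    pose proof (INR_fact_neq_0 k); pose proof (not_0_INR (S k) ltac:(lia)); field; auto.
Qed.

Lemma is_derive_sin_approx (n : nat) (x : R) :
  is_derive (fun x => sin_approx x n) x (cos_approx x n).
Proof.
  unfold sin_approx, cos_approx.
  induction n as [|n IH].
  - simpl; unfold sin_term, cos_term; simpl; auto_derive; [trivial | lra].
  - simpl sum_f_R0; apply (is_derive_plus (fun x => sum_f_R0 (sin_term x) n)); [exact IH|].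
    unfold sin_term, cos_term.
    replace (2 * S n + 1)%nat with (S (2 * S n)) by lia.
    apply is_derive_scal, is_derive_pow_fact.
Qed.

(** The constant term of the cosine polynomial is lost on differentiation, hence the index shift. *)
Lemma is_derive_cos_approx (n : nat) (x : R) :
  is_derive (fun x => cos_approx x (S n)) x (- sin_approx x n).
Proof.
  unfold sin_approx, cos_approx.
  induction n as [|n IH].
  - simpl; unfold sin_term, cos_term; simpl; auto_derive; [trivial | lra].
  - change (is_derive (fun x => sum_f_R0 (cos_term x) (S n) + cos_term x (S (S n))) x
      (- (sum_f_R0 (sin_term x) n + sin_term x (S n)))).
    rewrite Ropp_plus_distr.
    apply (is_derive_plus (fun x => sum_f_R0 (cos_term x) (S n))); [exact IH|].
    unfold sin_term, cos_term.
    replace (2 * S (S n))%nat with (S (2 * S n + 1)) by lia.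
    match goal with |- is_derive _ _ (- (?a * ?b)) => replace (- (a * b)) with (-1 * a * b) by ring end.
    apply is_derive_scal, is_derive_pow_fact.
Qed.

Lemma sin_approx_0 (n : nat) : sin_approx 0 n = 0.
Proof.
  unfold sin_approx; apply sum_eq_R0; intros m _.
  unfold sin_term; rewrite pow_ne_zero by lia; unfold Rdiv; ring.
Qed.

Lemma cos_approx_0 (n : nat) : cos_approx 0 n = 1.
Proof.
  unfold cos_approx; induction n as [|n IH].
  - unfold cos_term; simpl; field.
  - simpl sum_f_R0; rewrite IH.
    unfold cos_term; rewrite (pow_ne_zero (2 * S n)) by lia; unfold Rdiv; ring.
Qed.

(** Starting from cos <= 1, each remainder is integrated from 0 to give the next, alternately for
    sine and cosine. No upper limit on [x] is imposed, since the bounds are applied at [2 * x],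
    which may exceed [PI]. *)
Lemma sin_cos_approx_sign (n : nat) (x : R) : 0 <= x ->
  0 <= (-1) ^ n * (cos_approx x n - cos x) /\
  0 <= (-1) ^ n * (sin_approx x n - sin x).
Proof.
  assert (sin_step : forall m, (forall x, 0 <= x -> 0 <= (-1) ^ m * (cos_approx x m - cos x)) ->
    forall x, 0 <= x -> 0 <= (-1) ^ m * (sin_approx x m - sin x)).
  { intros m IH; apply (nonneg_of_deriv _ (fun x => (-1) ^ m * (cos_approx x m - cos x))); auto.
    - intros y; apply is_derive_scal, (is_derive_minus (V := R_NormedModule));
        [apply is_derive_sin_approx | auto_derive; [trivial | ring]].
    - rewrite sin_0, sin_approx_0; lra. }
  assert (cos_sign : forall x, 0 <= x -> 0 <= (-1) ^ n * (cos_approx x n - cos x)).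
  { induction n as [|n IH].
    - intros y _; unfold cos_approx, cos_term; simpl; pose proof (COS_bound y); lra.
    - apply (nonneg_of_deriv _ (fun x => (-1) ^ S n * (- sin_approx x n - - sin x))).
      + intros y; apply is_derive_scal, (is_derive_minus (V := R_NormedModule));
          [apply is_derive_cos_approx | auto_derive; [trivial | ring]].
      + intros y Hy; pose proof (sin_step n IH y Hy); simpl; lra.
      + rewrite cos_0, cos_approx_0; lra. }
  split; auto.
Qed.

Lemma sin_cos_le_approx (n : nat) (x : R) : 0 <= x ->
  cos x <= cos_approx x (2 * n) /\ sin x <= sin_approx x (2 * n).
Proof.
  intros Hx; destruct (sin_cos_approx_sign (2 * n) x Hx) as [Hc Hs].
  rewrite pow_1_even in Hc, Hs; lra.
Qed.

Lemma sin_cos_ge_approx (n : nat) (x : R) : 0 <= x ->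
  cos_approx x (S (2 * n)) <= cos x /\ sin_approx x (S (2 * n)) <= sin x.
Proof.
  intros Hx; destruct (sin_cos_approx_sign (S (2 * n)) x Hx) as [Hc Hs].
  rewrite pow_1_odd in Hc, Hs; lra.
Qed.

(* Evaluates the factorials in [R], since [fact 20] is out of reach in unary. *)
Ltac expand_approx H :=
  unfold cos_approx, sin_approx in H; cbn [Nat.mul Nat.add sum_f_R0] in H;
  unfold cos_term, sin_term in H; cbn [Nat.mul Nat.add] in H;
  rewrite ?fact_simpl, ?mult_INR, ?INR_IZR_INZ in H;
  cbn [Z.of_nat Pos.of_succ_nat Pos.succ fact] in H.

(** * Sign of the logarithm-free derivative *)

(* [x ^ 3 * sin x ^ 2] times the derivative of [log_gap_slope c] below. *)
Definition numer (c x : R) : R :=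
  x * (x - sin x) * (1 - cos x)
  + (3 / 2 + c * x ^ 2) * (2 * sin x ^ 2 - x ^ 2 - x * cos x * sin x)
  - 4 * c * x ^ 2 * sin x ^ 2 + 4 * c * x ^ 3 * cos x * sin x.

(** With products of sines and cosines gone, each trigonometric term can be replaced by a Taylor
    bound chosen by the sign of its coefficient. *)
Lemma numer_double_angle (c x : R) : numer c x =
  x ^ 2 - x ^ 2 * cos x - x * sin x + (3 / 2 + c * x ^ 2) * (1 - x ^ 2) - 2 * c * x ^ 2
  - (3 / 2 - c * x ^ 2) * cos (2 * x) - (1 / 4) * (x * sin (2 * x))
  + 3 / 2 * c * (x ^ 3 * sin (2 * x)).
Proof.
  unfold numer; rewrite cos_2a_sin, sin_2a; field.
Qed.

(** The value 1/80 cancels the [x ^ 6] term of [numer], whose expansion at 0 then starts at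
    [x ^ 8]. *)
Lemma numer_pos (x : R) : 0 < x < 3.1 -> 0 < numer (1 / 80) x.
Proof.
  intros Hx; rewrite numer_double_angle.
  destruct (sin_cos_le_approx 2 x ltac:(lra)) as [C S].
  destruct (sin_cos_le_approx 3 (2 * x) ltac:(lra)) as [C2 S2].
  expand_approx C; expand_approx S; expand_approx C2; expand_approx S2.
  assert (H2 : 0 < x ^ 2 < 10) by (simpl; nra).
  assert (Hp : 0 <= 3 / 2 - 1 / 80 * x ^ 2) by lra.
  (* Up to sign, the total coefficient of [sin (2 * x)]; its sign is constant here, so one bound
     serves both terms. *)
  assert (Hq : 0 <= x * (1 / 4 - 3 / 160 * x ^ 2)) by nra.
  apply (Rmult_le_compat_l (x ^ 2)) in C; [|lra].
  apply (Rmult_le_compat_l x) in S; [|lra].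
  apply (Rmult_le_compat_l _ _ _ Hp) in C2.
  apply (Rmult_le_compat_l _ _ _ Hq) in S2.
  (* Expanded around [x ^ 2 = 10], the Taylor minorant has only positive coefficients. *)
  set (w := 10 - x ^ 2).
  assert (Q : 0 < x ^ 8 * (7697/64864800 + w * (101/665280 + w * (179/81081000
      + w * (2/10135125 + w * (1/40540500)))))).
  { assert (0 < w) by (unfold w; lra).
    repeat first [assumption | apply pow_lt; lra | lra | apply Rmult_lt_0_compat | apply Rplus_lt_0_compat]. }
  unfold w in Q.
  lra.
Qed.

Lemma numer_neg (x : R) : 0 < x < 3.1 -> numer (1 / 20) x < 0.
Proof.
  intros Hx; rewrite numer_double_angle.
  destruct (sin_cos_ge_approx 2 x ltac:(lra)) as [C S].
  destruct (sin_cos_ge_approx 4 (2 * x) ltac:(lra)) as [C2 S2].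
  (* For c = 1/20 the total coefficient of [sin (2 * x)] changes sign at x^2 = 10/3, so its two
     terms are bounded separately, from opposite sides. *)
  destruct (sin_cos_le_approx 5 (2 * x) ltac:(lra)) as [_ S2'].
  expand_approx C; expand_approx S; expand_approx C2; expand_approx S2; expand_approx S2'.
  (* 3.1^2 = 9.61. *)
  assert (H2 : 0 < x ^ 2 < 97 / 10) by (simpl; nra).
  assert (Hp : 0 <= 3 / 2 - 1 / 20 * x ^ 2) by lra.
  apply (Rmult_le_compat_l (x ^ 2)) in C; [|lra].
  apply (Rmult_le_compat_l x) in S; [|lra].
  apply (Rmult_le_compat_l _ _ _ Hp) in C2.
  apply (Rmult_le_compat_l x) in S2; [|lra].
  apply (Rmult_le_compat_l (x ^ 3)) in S2'; [|apply pow_le; lra].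
  (* Expanded in powers of [97 / 10 - x ^ 2], the Taylor majorant divided by [x ^ 6] has
     only negative coefficients, so these facts suffice for [lra]. *)
  assert (Q : forall k, 0 < x ^ 6 * (97 / 10 - x ^ 2) ^ k).
  { intros k; apply Rmult_lt_0_compat; apply pow_lt; lra. }
  pose proof (Q 0%nat); pose proof (Q 1%nat); pose proof (Q 2%nat); pose proof (Q 3%nat);
  pose proof (Q 4%nat); pose proof (Q 5%nat); pose proof (Q 6%nat); pose proof (Q 7%nat);
  pose proof (Q 8%nat); pose proof (Q 9%nat).
  clear Q; lra.
Qed.

(** * Positivity from the derivative on an open interval *)

(** The linear minorant replaces a limit at 0, so nothing is asked of [f] at 0 itself. As [f]
    increases strictly, it is enough that [f (x / 2)] is not negative. *)
Lemma pos_of_deriv (f df : R -> R) (b C : R) :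
  (forall x, 0 < x < b -> is_derive f x (df x)) -> (forall x, 0 < x < b -> 0 < df x) ->
  (forall x, 0 < x < 1 -> - (C * x) <= f x) ->
  forall x, 0 < x < b -> 0 < f x.
Proof.
  intros Hd Hp H0.
  assert (incr : forall x y, 0 < x -> x < y -> y < b -> f x < f y).
  { intros x y Hx Hxy Hy.
    destruct (MVT_gen f x y df) as [z [Hz E]];
      rewrite ?Rmin_left, ?Rmax_right in * by lra.
    - intros z Hz; apply Hd; lra.
    - intros z Hz; apply continuity_pt_filterlim, (ex_derive_continuous (V := R_NormedModule)).
      eexists; apply Hd; lra.
    - assert (0 < df z) by (apply Hp; lra); nra. }
  intros x Hx.
  apply Rle_lt_trans with (f (x / 2)); [|apply incr; lra].
  apply Rnot_lt_le; intros Hneg.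
  pose proof (Rabs_pos C) as HC; pose proof (Rle_abs C).
  (* A point [y <= d] gives [C * y < - f (x / 2)], hence [f y > f (x / 2)], against monotonicity. *)
  set (d := - f (x / 2) / (Rabs C + 1)).
  assert (Hd0 : 0 < d) by (apply Rdiv_lt_0_compat; lra).
  assert (Ed : d * (Rabs C + 1) = - f (x / 2)) by (unfold d; field; lra).
  set (y := Rmin (Rmin d (1 / 2)) (x / 4)).
  assert (y <= d) by (unfold y; eapply Rle_trans; [apply Rmin_l | apply Rmin_l]).
  assert (y <= 1 / 2) by (unfold y; eapply Rle_trans; [apply Rmin_l | apply Rmin_r]).
  assert (y <= x / 4) by apply Rmin_r.
  assert (0 < y) by (unfold y; repeat apply Rmin_pos; lra).
  pose proof (incr y (x / 2) ltac:(lra) ltac:(lra) ltac:(lra)).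
  pose proof (H0 y ltac:(lra)).
  nra.
Qed.

(** * The logarithmic gap and its derivatives *)

Definition neg_ln_sinc (x : R) : R := - ln (sin x / x).

Definition neg_ln_cos2 (x : R) : R := - (2 * ln (cos (x / 2))).

(** The G of the overview, with A = [neg_ln_sinc] and B = [neg_ln_cos2]. *)
Definition log_gap (c x : R) : R := neg_ln_cos2 x - (3 / 2 + c * x ^ 2) * neg_ln_sinc x.

(* [log_gap c]' divided by [x], using [tan (x / 2) = (1 - cos x) / sin x]. *)
Definition log_gap_slope (c x : R) : R :=
  (x * (1 - cos x) - (3 / 2 + c * x ^ 2) * (sin x - x * cos x)) / (x ^ 2 * sin x)
  - 2 * c * neg_ln_sinc x.

Lemma is_derive_neg_ln_sinc (x : R) : 0 < x < PI ->
  is_derive neg_ln_sinc x ((sin x - x * cos x) / (x * sin x)).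
Proof.
  intros Hx; unfold neg_ln_sinc.
  pose proof (sin_gt_0 x ltac:(lra) ltac:(lra)).
  auto_derive.
  - repeat split; [lra | apply Rdiv_lt_0_compat; lra].
  - field; lra.
Qed.

Lemma is_derive_neg_ln_cos2 (x : R) : 0 < x < PI ->
  is_derive neg_ln_cos2 x ((1 - cos x) / sin x).
Proof.
  intros Hx; unfold neg_ln_cos2.
  assert (0 < cos (x / 2)) by (apply cos_gt_0; lra).
  assert (0 < sin (x / 2)) by (apply sin_gt_0; lra).
  auto_derive; [assumption|].
  replace (cos x) with (cos (2 * (x / 2))) by (f_equal; field).
  replace (sin x) with (sin (2 * (x / 2))) by (f_equal; field).
  rewrite cos_2a_sin, sin_2a.
  change (x * / 2) with (x / 2); field; lra.
Qed.

Lemma is_derive_log_gap (c x : R) : 0 < x < PI ->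
  is_derive (log_gap c) x (x * log_gap_slope c x).
Proof.
  intros Hx.
  pose proof (sin_gt_0 x ltac:(lra) ltac:(lra)).
  replace (x * log_gap_slope c x) with
    ((1 - cos x) / sin x - (c * (2 * x) * neg_ln_sinc x
      + (3 / 2 + c * x ^ 2) * ((sin x - x * cos x) / (x * sin x)))).
  - apply (is_derive_minus (V := R_NormedModule)); [now apply is_derive_neg_ln_cos2|].
    apply (is_derive_mult (K := R_AbsRing)
      (fun x => 3 / 2 + c * x ^ 2) neg_ln_sinc); [|now apply is_derive_neg_ln_sinc|apply Rmult_comm].
    auto_derive; [trivial | ring].
  - unfold log_gap_slope; field; lra.
Qed.

(** Division by [x] left the logarithm with the constant coefficient [- 2 * c], so one more
    derivative removes it. *)
Lemma is_derive_log_gap_slope (c x : R) : 0 < x < PI ->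
  is_derive (log_gap_slope c) x (numer c x / (x ^ 3 * sin x ^ 2)).
Proof.
  intros Hx.
  pose proof (sin_gt_0 x ltac:(lra) ltac:(lra)).
  unfold log_gap_slope.
  evar (d : R).
  assert (D : is_derive (fun x => (x * (1 - cos x) - (3 / 2 + c * x ^ 2) * (sin x - x * cos x))
    / (x ^ 2 * sin x)) x d).
  { unfold d; auto_derive; [|reflexivity].
    assert (0 < x ^ 2 * sin x) by (apply Rmult_lt_0_compat; [apply pow_lt|]; lra); simpl in *; lra. }
  replace (numer c x / _) with (d - 2 * c * ((sin x - x * cos x) / (x * sin x))).
  - apply (is_derive_minus (V := R_NormedModule)); [exact D|].
    apply (is_derive_scal neg_ln_sinc); now apply is_derive_neg_ln_sinc.
  - unfold d, numer; clear D d.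
    assert (C2 : cos x ^ 2 = 1 - sin x ^ 2) by (rewrite <- !Rsqr_pow2; apply cos2).
    field_simplify_eq; [|lra]; ring [C2].
Qed.

(** * Estimates near 0 *)

(** Uses ln t <= t - 1 at t = 1/z and (1 - d)(1 + 2d) >= 1. *)
Lemma neg_ln_bounds (z d : R) : 0 <= d <= 1 / 6 -> 1 - d <= z <= 1 -> 0 <= - ln z <= 2 * d.
Proof.
  intros Hd Hz; split.
  - assert (ln z <= ln 1) by (apply Rcomplements.ln_le; lra).
    rewrite ln_1 in *; lra.
  - rewrite <- ln_Rinv by lra.
    assert (ln (/ z) <= / z - 1).
    { pose proof (exp_ineq1_le (ln (/ z))) as E.
      rewrite exp_ln in E by (apply Rinv_0_lt_compat; lra); lra. }
    assert (/ z <= / (1 - d)) by (apply Rinv_le_contravar; lra).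
    assert (/ (1 - d) <= 1 + 2 * d).
    { apply (Rmult_le_reg_r (1 - d)); [lra|]; rewrite Rinv_l by lra; nra. }
    lra.
Qed.

Lemma sin_bounds_near_0 (x : R) : 0 < x < 1 ->
  x - x ^ 3 / 6 <= sin x <= x - x ^ 3 / 6 + x ^ 5 / 120.
Proof.
  intros Hx.
  destruct (sin_cos_ge_approx 0 x ltac:(lra)) as [_ L].
  destruct (sin_cos_le_approx 1 x ltac:(lra)) as [_ U].
  expand_approx L; expand_approx U; lra.
Qed.

Lemma cos_bounds_near_0 (x : R) : 0 < x < 1 ->
  1 - x ^ 2 / 2 <= cos x <= 1 - x ^ 2 / 2 + x ^ 4 / 24.
Proof.
  intros Hx.
  destruct (sin_cos_ge_approx 0 x ltac:(lra)) as [L _].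
  destruct (sin_cos_le_approx 1 x ltac:(lra)) as [U _].
  expand_approx L; expand_approx U; lra.
Qed.

Lemma neg_ln_sinc_near_0 (x : R) : 0 < x < 1 -> 0 <= neg_ln_sinc x <= x ^ 2.
Proof.
  intros Hx; destruct (sin_bounds_near_0 x Hx) as [L _].
  pose proof (sin_lt_x x ltac:(lra)).
  assert (0 < x ^ 2 < 1) by (simpl; nra).
  destruct (neg_ln_bounds (sin x / x) (x ^ 2 / 6)); [lra| |unfold neg_ln_sinc; lra].
  split; apply (Rmult_le_reg_r x); try lra; unfold Rdiv; rewrite (Rmult_assoc (sin x)), Rinv_l by lra; lra.
Qed.

Lemma neg_ln_cos2_near_0 (x : R) : 0 < x < 1 -> 0 <= neg_ln_cos2 x <= x ^ 2.
Proof.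
  intros Hx; destruct (cos_bounds_near_0 (x / 2) ltac:(lra)) as [L _].
  pose proof (COS_bound (x / 2)).
  assert (0 < x ^ 2 < 1) by (simpl; nra).
  destruct (neg_ln_bounds (cos (x / 2)) (x ^ 2 / 8)); [lra|lra|unfold neg_ln_cos2; lra].
Qed.

Lemma log_gap_near_0 (c x : R) : 0 <= c <= 1 -> 0 < x < 1 -> - (3 * x) <= log_gap c x <= 3 * x.
Proof.
  intros Hc Hx; unfold log_gap.
  pose proof (neg_ln_sinc_near_0 x Hx); pose proof (neg_ln_cos2_near_0 x Hx).
  assert (0 < x ^ 2 < x) by (simpl; nra).
  assert (0 <= c * x ^ 2 <= 1) by nra.
  nra.
Qed.

(** The cubic terms of x(1 - cos x) and 3/2 (sin x - x cos x) cancel, leaving a numerator of order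
    x^5 over a denominator of at least x^3/2. *)
Lemma log_gap_slope_near_0 (c x : R) : 0 <= c <= 1 -> 0 < x < 1 ->
  - (10 * x) <= log_gap_slope c x <= 10 * x.
Proof.
  intros Hc Hx; unfold log_gap_slope.
  pose proof (neg_ln_sinc_near_0 x Hx) as HA.
  pose proof (sin_bounds_near_0 x Hx) as HS; pose proof (cos_bounds_near_0 x Hx) as HC.
  assert (H2 : 0 < x ^ 2 < x) by (simpl; nra).
  assert (HS0 : x / 2 <= sin x) by (simpl in *; nra).
  assert (H5 : 0 < x ^ 5) by (apply pow_lt; lra).
  (* [e] and [h] are the Taylor remainders left after that cancellation. *)
  set (e := cos x - (1 - x ^ 2 / 2)) in *.
  set (h := sin x - (x - x ^ 3 / 6)) in *.
  assert (He : 0 <= x * e <= x ^ 5 / 24) by (unfold e; simpl in *; nra).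
  assert (Hh : 0 <= h <= x ^ 5 / 120) by (unfold h; lra).
  assert (Hk : 0 <= x ^ 2 * (sin x - x * cos x) <= x ^ 5).
  { replace (x ^ 2 * (sin x - x * cos x)) with (x ^ 5 / 3 + x ^ 2 * (h - x * e)) by (unfold h, e; field).
    assert (- (x ^ 5 / 24) <= x ^ 2 * (h - x * e) <= x ^ 5 / 24) by nra.
    lra. }
  set (k := x ^ 2 * (sin x - x * cos x)) in *.
  replace (x * (1 - cos x) - (3 / 2 + c * x ^ 2) * (sin x - x * cos x))
    with (x * e / 2 - 3 / 2 * h - c * k) by (unfold h, e, k; field).
  assert (Hn : - (2 * x ^ 5) <= x * e / 2 - 3 / 2 * h - c * k <= 2 * x ^ 5) by nra.
  set (n := x * e / 2 - 3 / 2 * h - c * k) in *.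
  assert (Hd : x ^ 3 / 2 <= x ^ 2 * sin x) by (simpl in *; nra).
  assert (H3 : 0 < x ^ 3) by (apply pow_lt; lra).
  set (q := n / (x ^ 2 * sin x)).
  assert (Hq : q * (x ^ 2 * sin x) = n) by (unfold q; field; lra).
  assert (- (4 * x ^ 2) <= q <= 4 * x ^ 2).
  { assert (x ^ 5 = x ^ 2 * x ^ 3) by ring.
    split; apply (Rmult_le_reg_r (x ^ 2 * sin x)); try lra; rewrite Hq; nra. }
  nra.
Qed.

(** * Assembling the two inequalities *)

(** The sign [s], which is 1 or -1, lets one argument serve both inequalities: [pos_of_deriv] passes
    from [numer] to the slope, then from the slope to the gap. *)
Lemma log_gap_pos (s c : R) : s ^ 2 = 1 -> 0 <= c <= 1 ->
  (forall x, 0 < x < 3.1 -> 0 < s * numer c x) ->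
  forall x, 0 < x < 3.1 -> 0 < s * log_gap c x.
Proof.
  intros Hs Hc Hnum.
  pose proof PI_gt_3_1.
  assert (Hs1 : -1 <= s <= 1) by (simpl in Hs; nra).
  apply (pos_of_deriv _ (fun x => s * (x * log_gap_slope c x)) _ 3).
  - intros x Hx; apply is_derive_scal, is_derive_log_gap; lra.
  - intros x Hx.
    replace (s * (x * log_gap_slope c x)) with (x * (s * log_gap_slope c x)) by ring.
    apply Rmult_lt_0_compat; [lra|].
    revert x Hx.
    apply (pos_of_deriv _ (fun x => s * (numer c x / (x ^ 3 * sin x ^ 2))) _ 10).
    + intros x Hx; apply is_derive_scal, is_derive_log_gap_slope; lra.
    + intros x Hx; unfold Rdiv; rewrite <- Rmult_assoc.
      apply Rdiv_lt_0_compat; [now apply Hnum|].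
      apply Rmult_lt_0_compat; apply pow_lt; [lra | apply sin_gt_0; lra].
    + intros x Hx; pose proof (log_gap_slope_near_0 c x Hc Hx); nra.
  - intros x Hx; pose proof (log_gap_near_0 c x Hc Hx); nra.
Qed.

Theorem theorem8 (x : R) (hx : 0 < x < 3.1) :
  Rpower (sin x / x) (p1 x) < cos (x / 2) ^ 2 < Rpower (sin x / x) (p2 x).
Proof.
  pose proof PI_gt_3_1; pose proof PI_sqr_lt_10.
  assert (0 < sin x) by (apply sin_gt_0; lra).
  assert (0 < cos (x / 2)) by (apply cos_gt_0; lra).
  assert (Hcos : cos (x / 2) ^ 2 = exp (- neg_ln_cos2 x)).
  { unfold neg_ln_cos2; rewrite Ropp_involutive, <- (Rpower_pow 2) by assumption; reflexivity. }
  assert (HA : 0 < neg_ln_sinc x).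
  { unfold neg_ln_sinc.
    assert (sin x / x < 1) by (apply Rlt_div_l; [lra | pose proof (sin_lt_x x); lra]).
    assert (ln (sin x / x) < ln 1) by (apply ln_increasing; [apply Rdiv_lt_0_compat|]; lra).
    rewrite ln_1 in *; lra. }
  rewrite Hcos; unfold Rpower; split; apply exp_increasing.
  - assert (L : 0 < -1 * log_gap (1 / 20) x).
    { apply log_gap_pos; [ring | lra | | assumption].
      intros y Hy; pose proof (numer_neg y Hy); lra. }
    (* From PI^2 < 10; as [neg_ln_sinc x] is positive, the larger exponent [p1 x] only lowers the
       power. *)
    assert (Hp : 3 / 2 + 1 / 20 * x ^ 2 <= p1 x).
    { unfold p1, Rdiv at 4; rewrite (Rmult_comm (x ^ 2)).
      apply Rplus_le_compat_l, Rmult_le_compat_r; [apply pow_le; lra|].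
      unfold Rdiv; rewrite Rmult_1_l; apply Rinv_le_contravar; [|lra].
      assert (0 < PI ^ 2) by (apply pow_lt; lra); lra. }
    unfold log_gap in L; unfold neg_ln_sinc in *; nra.
  - assert (U : 0 < 1 * log_gap (1 / 80) x).
    { apply log_gap_pos; [ring | lra | | assumption].
      intros y Hy; pose proof (numer_pos y Hy); lra. }
    unfold log_gap, neg_ln_sinc in U; unfold p2; lra.
Qed.
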